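(* Let $q\in(0,1)$. Then $$\lim_{n\to\infty}\big(P_n^q(S_n(132))\big)^{\frac1n}=\lim_{n\to\infty}\big(P_n^q(S_n(213))\big)^{\frac1n}=1-q.$$
   Context: $S_n$ is the set of permutations $\sigma=\sigma_1\cdots\sigma_n$ of $[n]=\{1,\dots,n\}$, where $\sigma_i=\sigma(i)$. For $\tau\in S_m$ with $2\le m\le n$, $\sigma\in S_n$ contains $\tau$ as a pattern if there are indices $1\le i_1<\cdots<i_m\le n$ such that for all $1\le j,k\le m$, $\sigma_{i_j}<\sigma_{i_k}$ if and only if $\tau_j<\tau_k$; otherwise $\sigma$ avoids $\tau$. $S_n(\tau)$ is the set of $\sigma\in S_n$ avoiding $\tau$ (and $S_n(\tau)=S_n$ if $m>n$). For $q>0$, the Mallows distribution with parameter $q$ is the probability measure on $S_n$ given by $P_n^q(\sigma)=q^{\mathrm{inv}(\sigma)}/Z_n(q)$, where $\mathrm{inv}(\sigma)$ is the number of inversions of $\sigma$, i.e. pairs $i<j$ with $\sigma_i>\sigma_j$, and $Z_n(q)=\sum_{\sigma\in S_n}q^{\mathrm{inv}(\sigma)}$, which for $q\neq 1$ equals $\prod_{k=1}^n\frac{1-q^k}{1-q}$. *)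

(* Defs.v *)
From HB Require Import structures.
From mathcomp Require Import all_boot all_order all_fingroup all_algebra.
From mathcomp Require Import all_classical all_reals all_analysis.

Set Implicit Arguments.
Unset Strict Implicit.
Unset Printing Implicit Defensive.

Import Order.TTheory GRing.Theory Num.Theory.
Import numFieldNormedType.Exports.

Local Open Scope ring_scope.

(* Permutations of {1, ..., n} are elements of 'S_n, i.e. permutations of
   'I_n = {0, ..., n-1}: both positions and values are shifted down by one. *)

(* [f] lists the positions i_1 < ... < i_m of an occurrence of [tau]. *)
Definition occurrence (m n : nat) (tau : 'S_m) (sigma : 'S_n)
    (f : {ffun 'I_m -> 'I_n}) : bool :=
  [forall j : 'I_m, forall k : 'I_m, (j < k)%N ==> (f j < f k)%N] &&
  [forall j : 'I_m, forall k : 'I_m,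
     (sigma (f j) < sigma (f k))%N == (tau j < tau k)%N].

Definition contains_pattern (m n : nat) (tau : 'S_m) (sigma : 'S_n) : bool :=
  [exists f : {ffun 'I_m -> 'I_n}, occurrence tau sigma f].

Definition avoiders (m n : nat) (tau : 'S_m) : {set 'S_n} :=
  [set sigma : 'S_n | ~~ contains_pattern tau sigma].

Lemma avoiders_gt (m n : nat) (tau : 'S_m) :
  (n < m)%N -> avoiders n tau = [set: 'S_n].
Proof.
move=> ltnm; apply/setP => sigma; rewrite !inE; apply/existsP => -[f].
case/andP => /forallP f_incr _.
have incr (j k : 'I_m) : (j < k)%N -> (f j < f k)%N.
  by move=> jk; move/forallP: (f_incr j) => /(_ k); rewrite jk.
have f_inj : injective f.
  move=> j k fjk; apply: ord_inj.
  case: (ltngtP (nat_of_ord j) (nat_of_ord k)) => // lt.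
    by have := incr _ _ lt; rewrite fjk ltnn.
  by have := incr _ _ lt; rewrite fjk ltnn.
by have := leq_card f f_inj; rewrite !card_ord leqNgt ltnm.
Qed.

Definition inversions (n : nat) (sigma : 'S_n) : nat :=
  #|[set ij : 'I_n * 'I_n |
      (ij.1 < ij.2)%N && (sigma ij.2 < sigma ij.1)%N]|.

Definition mallows_Z (R : realType) (n : nat) (q : R) : R :=
  \sum_(sigma : 'S_n) q ^+ inversions sigma.

Definition mallows_pmf (R : realType) (n : nat) (q : R) (sigma : 'S_n) : R :=
  q ^+ inversions sigma / mallows_Z n q.

Definition mallows_prob (R : realType) (n : nat) (q : R) (A : {set 'S_n}) : R :=
  \sum_(sigma in A) mallows_pmf q sigma.

Definition pattern132 : 'S_3 := tperm (inord 1) (inord 2).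

Definition pattern213 : 'S_3 := tperm (inord 0) (inord 1).

(* One-line notations, with values shifted back to {1, 2, 3}. *)
Lemma pattern132E :
  [seq (val (pattern132 i)).+1 | i <- enum 'I_3] = [:: 1; 3; 2]%N.
Proof.
rewrite !enum_ordSl enum_ord0 /= /pattern132 !permE /= -!val_eqE /= !inordK //=.
Qed.

Lemma pattern213E :
  [seq (val (pattern213 i)).+1 | i <- enum 'I_3] = [:: 2; 1; 3]%N.
Proof.
rewrite !enum_ordSl enum_ord0 /= /pattern213 !permE /= -!val_eqE /= !inordK //=.
Qed.

Lemma mallows_Z_gt0 (R : realType) (n : nat) (q : R) (q0 : 0 < q) :
  0 < mallows_Z n q.
Proof.
rewrite /mallows_Z (bigD1 (1%g : 'S_n)) //= ltr_pwDl ?exprn_gt0 //.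
by apply: sumr_ge0 => s _; rewrite exprn_ge0 // ltW.
Qed.

Lemma mallows_probT (R : realType) (n : nat) (q : R) (q0 : 0 < q) :
  mallows_prob q [set: 'S_n] = 1.
Proof.
rewrite /mallows_prob /mallows_pmf -mulr_suml.
rewrite (eq_bigl xpredT) => [|s]; last by rewrite inE.
by rewrite divff // gt_eqF // mallows_Z_gt0.
Qed.

(* Main.v *)
Require Import Defs.
From mathcomp Require Import all_boot all_order all_fingroup all_algebra.
From mathcomp Require Import all_classical all_reals all_analysis.

Import Order.TTheory GRing.Theory Num.Theory.
Import numFieldNormedType.Exports.

Local Open Scope ring_scope.

(* The Lehmer code c_i = #{j > i : s_j < s_i} is a bijection from S_n onto the
   product of the intervals [0, n - i), and inv s is the sum of the c_i; hence
   Z_n = E_n / (1 - q)^n with E_n = \prod_(k = 1 .. n) (1 - q^k). If s avoids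
   132, its code is nonincreasing, so s is determined by the drops
   d_i = c_i - c_(i+1), and inv s is the sum of the (i + 1) d_i over i >= 0; hence
   the avoiders have total weight at most 1 / E_n, and at least 1 because of the
   identity. Since E_n stays above a positive constant, the probability lies
   between (1 - q)^n and K (1 - q)^n. Conjugation by the reversal of [n]
   preserves inv and exchanges 132 and 213. *)

(** * The Lehmer code and the normalizing constant *)

Definition lehmer {n} (s : 'S_n) (i : 'I_n) : nat :=
  #|[set j : 'I_n | (i < j)%N && (s j < s i)%N]|.

Lemma big_ord_lt (T : Type) (idx : T) (op : T -> T -> T) (F : nat -> T) m n :
  (m <= n)%N -> \big[op/idx]_(i < n | (i < m)%N) F i = \big[op/idx]_(i < m) F i.
Proof.
by move=> le_mn; rewrite -[RHS](big_mkord xpredT) (big_nat_widen _ _ n)// big_mkord.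
Qed.

Lemma card_ord_lt m n : (m <= n)%N -> #|[pred i : 'I_n | (i < m)%N]| = m.
Proof.
move=> le_mn; rewrite -sum1_card (big_ord_lt _ _ _ (fun=> 1%N))//.
by rewrite sum_nat_const card_ord muln1.
Qed.

Lemma sum_lehmer {n} (s : 'S_n) : (\sum_i lehmer s i)%N = inversions s.
Proof.
rewrite /inversions -sum1_card.
rewrite (eq_bigl (fun ij : 'I_n * 'I_n => (ij.1 < ij.2)%N && (s ij.2 < s ij.1)%N));
  last by move=> ij; rewrite inE.
rewrite -(pair_big_dep xpredT (fun i j : 'I_n => (i < j)%N && (s j < s i)%N)
  (fun _ _ => 1%N)) /=.
apply: eq_bigr => i _; rewrite /lehmer -sum1_card.
by apply: eq_bigl => j; rewrite inE.
Qed.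

Lemma lehmer_lt {n} (s : 'S_n) (i : 'I_n) : (lehmer s i < n - i)%N.
Proof.
have sub : [set j : 'I_n | (i < j)%N && (s j < s i)%N] \subset
    [set j : 'I_n | (i < j)%N].
  by apply/fintype.subsetP => j; rewrite !inE => /andP[].
apply: leq_ltn_trans (subset_leq_card sub) _.
have := cardC [pred j : 'I_n | (j < i.+1)%N].
rewrite card_ord card_ord_lt// => e.
rewrite (@eq_card _ _ [predC [pred j : 'I_n | (j < i.+1)%N]]); last first.
  by move=> j; rewrite !inE -leqNgt.
by rewrite -[X in (_ < X - _)%N]e addSnnS addKn.
Qed.

(* [s i] is the element of rank [lehmer s i] among the values not taken before
   position [i]. *)
Lemma lehmer_inj {n} (s t : 'S_n) : lehmer s =1 lehmer t -> s = t.
Proof.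
move=> eq_st.
(* The map [v^-1 u] injects the positions counted by [lehmer u i] into those counted by
   [lehmer v i], and it misses the position where [v] takes the value [u i]. *)
have step (u v : 'S_n) (i : 'I_n) : (forall j : 'I_n, (j < i)%N -> u j = v j) ->
    (u i < v i)%N -> (lehmer u i < lehmer v i)%N.
  move=> uv lt_uv.
  have tail (j : 'I_n) : (i <= j)%N -> (i <= v^-1%g (u j))%N.
    move=> ij; rewrite leqNgt; apply/negP => lt.
    have /perm_inj e := etrans (uv _ lt) (permKV v (u j)).
    by rewrite e ltnNge ij in lt.
  have w_inj : injective (fun j => v^-1%g (u j)).
    by move=> j k /perm_inj /perm_inj.
  rewrite /lehmer -(card_imset _ w_inj); apply: proper_card.
  apply/properP; split.
    apply/fintype.subsetP => k /imsetP[j]; rewrite !inE => /andP[ij ltj] ->.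
    rewrite permKV (ltn_trans ltj lt_uv) andbT ltn_neqAle tail ?(ltnW ij)// andbT.
    apply/negP => /eqP/val_inj e.
    by have := ltn_trans ltj lt_uv; rewrite e permKV ltnn.
  exists (v^-1%g (u i)).
    rewrite inE permKV lt_uv andbT ltn_neqAle tail// andbT.
    by apply/negP => /eqP/val_inj e; move: lt_uv; rewrite [X in v X]e permKV ltnn.
  by apply/imsetP => -[j]; rewrite inE => /andP[ij _] /w_inj e; rewrite e ltnn in ij.
apply/permP => i; have [m] := ubnP i; elim: m i => // m IH i le_im.
have prev (j : 'I_n) : (j < i)%N -> s j = t j.
  by move=> ji; apply: IH; apply: leq_trans ji _.
apply: val_inj; case: (ltngtP (s i) (t i)) => // lt.
  by have := step s t i prev lt; rewrite eq_st ltnn.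
by have := step t s i (fun j ji => esym (prev j ji)) lt; rewrite eq_st ltnn.
Qed.

(** The common codomain ['I_n] gives a non-dependent finite function; the sharper bound [n - i]
    returns through [family]. *)
Definition lehmer_ffun {n} (s : 'S_n) : {ffun 'I_n -> 'I_n} :=
  [ffun i => Ordinal (leq_trans (lehmer_lt s i) (leq_subr i n))].

Lemma lehmer_ffun_inj {n} : injective (@lehmer_ffun n).
Proof.
move=> s t /ffunP e; apply: lehmer_inj => i.
by have := congr1 val (e i); rewrite !ffunE.
Qed.

Lemma prod_subn_ord n : (\prod_(i < n) (n - i) = n`!)%N.
Proof.
rewrite fact_prod big_add1 big_mkord (reindex_inj rev_ord_inj) /=.
by apply: eq_bigr => i _; rewrite subKn.
Qed.

(* The image of [lehmer_ffun] lies in a set of cardinal [n`!], hence fills it. *)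
Lemma codom_lehmer_ffun n : lehmer_ffun @: [set: 'S_n] =i
  family (fun i : 'I_n => [pred c : 'I_n | (c < n - i)%N]).
Proof.
have sub : lehmer_ffun @: [set: 'S_n] \subset
    family (fun i : 'I_n => [pred c : 'I_n | (c < n - i)%N]).
  apply/fintype.subsetP => _ /imsetP[s _ ->]; apply/familyP => i.
  by rewrite inE ffunE lehmer_lt.
apply/subset_cardP => //.
rewrite card_imset; last exact: lehmer_ffun_inj.
rewrite cardsT card_Sn -prod_subn_ord card_family foldrE big_map big_enum /=.
by apply: eq_bigr => i _; rewrite card_ord_lt// leq_subr.
Qed.

(** Summed over codes, the weight factors into one truncated geometric sum per position. *)
Lemma mallows_ZE (R : realType) n (q : R) : q < 1 ->
  mallows_Z n q = (\prod_(i < n) (1 - q ^+ i.+1)) / (1 - q) ^+ n.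
Proof.
move=> q1; have q1' : 1 - q != 0 by rewrite subr_eq0 gt_eqF.
have geo m : \sum_(c < m) q ^+ c = (1 - q ^+ m) / (1 - q).
  by rewrite -[X in X - _](expr1n _ m) subrXX mulrAC divff// mul1r;
    apply: eq_bigr => i _; rewrite expr1n mul1r.
transitivity (\sum_(f in lehmer_ffun @: [set: 'S_n]) \prod_i q ^+ f i).
  rewrite big_imset /=; last by move=> s t _ _; apply: lehmer_ffun_inj.
  rewrite /mallows_Z; apply: eq_big => [s|s _]; first by rewrite inE.
  rewrite -sum_lehmer expr_sum; apply: eq_bigr => i _.
  by rewrite ffunE.
rewrite (eq_bigl _ _ (codom_lehmer_ffun n)).
rewrite -(bigA_distr_big_dep _ (fun (i c : 'I_n) => q ^+ c)).
rewrite -[n in _ ^+ n]card_ord -prodr_const -prodf_div.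
(* Position [i] has [n - i] possible entries, so the factors appear in reverse order. *)
rewrite [RHS](reindex_inj rev_ord_inj); apply: eq_bigr => i _ /=.
rewrite subnSK// -geo.
by rewrite (big_ord_lt _ _ _ (fun c => q ^+ c))// leq_subr.
Qed.

(** * Codes and drops of 132-avoiding permutations *)

Lemma contains132 {n} (s : 'S_n) (i j k : 'I_n) :
  (i < j)%N -> (j < k)%N -> (s i < s k)%N -> (s k < s j)%N ->
  contains_pattern pattern132 s.
Proof.
move=> ij jk ik kj; have [ik' ij'] := (ltn_trans ij jk, ltn_trans ik kj).
apply/existsP; exists [ffun x : 'I_3 => tnth [tuple i; j; k] x].
have tnthE (x : 'I_3) : tnth [tuple i; j; k] x = nth i [:: i; j; k] x.
  by rewrite (tnth_nth i).
apply/andP; split; apply/forallP => -[[|[|[|x]]] hx] //; apply/forallP => -[[|[|[|y]]] hy] //;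
rewrite !ffunE !tnthE /pattern132 ?permE /= ?ltnn //= -!val_eqE /= !inordK //=
  ?ij ?jk ?ik ?kj ?ik' ?ij' ?ltnn //= ltnNge ltnW//.
Qed.

(** A position [k] counted at [j] but not at [i] would make [i], [j], [k] an occurrence of 132. *)
Lemma lehmer_avoid132 {n} (s : 'S_n) (i j : 'I_n) :
  s \in avoiders n pattern132 -> j = i.+1 :> nat -> (lehmer s j <= lehmer s i)%N.
Proof.
rewrite inE => avoid eq_j; have ij : (i < j)%N by rewrite eq_j.
apply/subset_leq_card/fintype.subsetP => k; rewrite !inE => /andP[jk kj].
rewrite (ltn_trans ij jk) /=; case: (ltngtP (s k) (s i)) => // [ik|/val_inj/perm_inj ki].
  by case/negP: avoid; apply: contains132 ij jk ik kj.
by move: jk; rewrite ki ltnNge ltnW.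
Qed.

Lemma id_avoid132 n : 1%g \in avoiders n pattern132.
Proof.
rewrite inE; apply/existsP => -[f /andP[/forallP incr /forallP pat]].
have := forallP (pat (inord 2)) (inord 1); have := forallP (incr (inord 1)) (inord 2).
rewrite !perm1 tpermL tpermR !inordK//= => lt12 /eqP lt21.
by have := ltn_trans lt12 lt21; rewrite ltnn.
Qed.

Lemma inversions1 n : inversions (1%g : 'S_n) = 0%N.
Proof.
apply: eq_card0 => -[i j]; rewrite inE /= !perm1.
by case: ltngtP.
Qed.

(** Extending the code by 0 makes the last drop an ordinary difference. *)
Definition lehmer_nat {n} (s : 'S_n) (k : nat) : nat := oapp (lehmer s) 0%N (insub k).

Lemma lehmer_natE {n} (s : 'S_n) (i : 'I_n) : lehmer_nat s i = lehmer s i.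
Proof. by rewrite /lehmer_nat valK. Qed.

Lemma lehmer_nat_ge {n} (s : 'S_n) k : (n <= k)%N -> lehmer_nat s k = 0%N.
Proof. by move=> le_nk; rewrite /lehmer_nat insubN// -leqNgt. Qed.

Lemma lehmer_nat_noninc {n} (s : 'S_n) k : s \in avoiders n pattern132 ->
  (lehmer_nat s k.+1 <= lehmer_nat s k)%N.
Proof.
move=> avoid; case: (ltnP k.+1 n) => [lt|/lehmer_nat_ge->//].
rewrite (lehmer_natE s (Ordinal lt)) (lehmer_natE s (Ordinal (ltnW lt))).
exact: lehmer_avoid132.
Qed.

(** The subtraction is truncated; it is a true difference when the code is nonincreasing, as for
    avoiders. *)
Definition drop_ffun {n} (s : 'S_n) : {ffun 'I_n -> 'I_n} :=
  [ffun i : 'I_n => Ordinal (leq_ltn_trans (leq_subr (lehmer_nat s i.+1) (lehmer s i))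
    (leq_trans (lehmer_lt s i) (leq_subr i n)))].

(** Abel summation; the boundary term vanishes for the extended code. *)
Lemma sum_drops (c : nat -> nat) n : (forall k, (c k.+1 <= c k)%N) ->
  (\sum_(i < n) i.+1 * (c i - c i.+1) + n * c n = \sum_(i < n) c i)%N.
Proof.
move=> dec; elim: n => [|n IH]; first by rewrite !big_ord0.
rewrite !big_ord_recr /= -IH -addnA -mulnDr subnK// mulSn.
by rewrite [(c n + _)%N]addnC addnA.
Qed.

Lemma sum_drop_ffun {n} (s : 'S_n) : s \in avoiders n pattern132 ->
  (\sum_(i < n) i.+1 * drop_ffun s i)%N = inversions s.
Proof.
move=> avoid; rewrite -sum_lehmer.
have := sum_drops (lehmer_nat s) n (fun k => lehmer_nat_noninc s k avoid).
rewrite lehmer_nat_ge// muln0 addn0 => e.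
transitivity (\sum_(i < n) lehmer_nat s i)%N.
  by rewrite -e; apply: eq_bigr => i _; rewrite ffunE /= lehmer_natE.
by apply: eq_bigr => i _; rewrite lehmer_natE.
Qed.

(** The code is rebuilt from right to left, starting from its zero value at [n] and adding one drop
    at a time. *)
Lemma drop_ffun_inj {n} : {in avoiders n pattern132 &, injective drop_ffun}.
Proof.
move=> s t avs avt /ffunP eq_st; apply: lehmer_inj => i.
suff eq_nat m k : (n - k <= m)%N -> lehmer_nat s k = lehmer_nat t k.
  by rewrite -!lehmer_natE; apply: (eq_nat n); rewrite leq_subr.
elim: m k => [|m IH] k; first by rewrite leqn0 subn_eq0 => le; rewrite !lehmer_nat_ge.
case: (ltnP k n) => [lt|le _]; last by rewrite !lehmer_nat_ge.
move=> le_m; have eqS : lehmer_nat s k.+1 = lehmer_nat t k.+1.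
  by apply: IH; rewrite subnS -ltnS prednK// subn_gt0.
have := congr1 val (eq_st (Ordinal lt)); rewrite !ffunE /= -!lehmer_natE /= => e.
rewrite -(subnK (lehmer_nat_noninc s k avs)) -(subnK (lehmer_nat_noninc t k avt)).
by rewrite e eqS.
Qed.

Lemma sum_avoid132_le (R : realType) n (q : R) : 0 < q -> q < 1 ->
  \sum_(s in avoiders n pattern132) q ^+ inversions s
    <= (\prod_(i < n) (1 - q ^+ i.+1))^-1.
Proof.
move=> q0 q1; have w0 (f : {ffun 'I_n -> 'I_n}) : 0 <= \prod_(i < n) (q ^+ i.+1) ^+ f i.
  by apply: prodr_ge0 => i _; rewrite !exprn_ge0// ltW.
have -> : \sum_(s in avoiders n pattern132) q ^+ inversions s =
    \sum_(f in drop_ffun @: avoiders n pattern132) \prod_(i < n) (q ^+ i.+1) ^+ f i.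
  rewrite big_imset /=; last exact: drop_ffun_inj.
  apply: eq_bigr => s avoid; rewrite -sum_drop_ffun// expr_sum.
  by apply: eq_bigr => i _; rewrite exprM.
(* Enlarging the sum to all functions makes it factor into truncated geometric sums. *)
apply: (@le_trans _ _ (\sum_(f : {ffun 'I_n -> 'I_n}) \prod_(i < n) (q ^+ i.+1) ^+ f i)).
  by rewrite [leRHS](bigID (mem (drop_ffun @: avoiders n pattern132))) /= lerDl sumr_ge0.
rewrite -(bigA_distr_bigA (fun (i c : 'I_n) => (q ^+ i.+1) ^+ c)) -prodfV.
apply: ler_prod => i _; set x := q ^+ i.+1.
have x0 : 0 <= x by rewrite exprn_ge0// ltW.
have x1 : x < 1 by rewrite exprn_ilt1// ltW.
rewrite sumr_ge0 /=; last by move=> c _; rewrite exprn_ge0.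
rewrite -[leRHS]mul1r ler_pdivlMr ?subr_gt0// mulrC -[_ * _]opprK -mulNr opprB.
rewrite -subrX1 opprB gerBl exprn_ge0//.
Qed.

(** * The reverse-complement symmetry between 132 and 213 *)

Definition rev_perm n : 'S_n := perm (@rev_ord_inj n).

Definition rev_compl {n} (s : 'S_n) : 'S_n := (s ^ rev_perm n)%g.

Lemma rev_complE {n} (s : 'S_n) i : rev_compl s i = rev_ord (s (rev_ord i)).
Proof.
have revE j : rev_perm n j = rev_ord j by rewrite permE.
by rewrite -[in LHS](rev_ordK i) -[in LHS](revE (rev_ord i)) permJ revE.
Qed.

Lemma rev_complK {n} : involutive (@rev_compl n).
Proof. by move=> s; apply/permP => i; rewrite !rev_complE !rev_ordK. Qed.

Lemma ltn_rev_ord {n} (i j : 'I_n) : (rev_ord i < rev_ord j)%N = (j < i)%N.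
Proof. by rewrite /= ltn_sub2lE. Qed.

Lemma rev_compl_pattern132 : rev_compl pattern132 = pattern213.
Proof.
apply/permP => i; rewrite rev_complE; apply: val_inj.
by case: i => -[|[|[|i]]] hi //; rewrite /pattern132 /pattern213 !permE /= -!val_eqE /= !inordK.
Qed.

Lemma contains_rev_compl {m n} (t : 'S_m) (s : 'S_n) :
  contains_pattern t s -> contains_pattern (rev_compl t) (rev_compl s).
Proof.
move=> /existsP[f /andP[/forallP incr /forallP pat]]; apply/existsP.
exists [ffun j => rev_ord (f (rev_ord j))]; apply/andP; split;
  apply/forallP => j; apply/forallP => k.
  have := forallP (incr (rev_ord k)) (rev_ord j).
  by rewrite !ffunE !ltn_rev_ord.
have := forallP (pat (rev_ord k)) (rev_ord j).
by rewrite !ffunE !rev_complE !rev_ordK !ltn_rev_ord.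
Qed.

Lemma avoiders_rev_compl {m n} (t : 'S_m) (s : 'S_n) :
  (rev_compl s \in avoiders n (rev_compl t)) = (s \in avoiders n t).
Proof.
rewrite !inE; congr (~~ _); apply/idP/idP; last exact: contains_rev_compl.
by move/contains_rev_compl; rewrite !rev_complK.
Qed.

(** Reversal flips both positions and values, so reflecting a pair and swapping its entries matches
    the inversions. *)
Lemma inversions_rev_compl {n} (s : 'S_n) : inversions (rev_compl s) = inversions s.
Proof.
pose h (ij : 'I_n * 'I_n) := (rev_ord ij.2, rev_ord ij.1).
have h_inj : injective h by move=> [i j] [k l] /pair_equal_spec[/rev_ord_inj/= -> /rev_ord_inj/= ->].
rewrite /inversions -[RHS](card_imset _ h_inj); apply: eq_card => -[i j].
rewrite inE /= !rev_complE !ltn_rev_ord; apply/idP/imsetP => [ij|[[k l] kl]].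
  by exists (h (i, j)); rewrite ?inE /= ?ltn_rev_ord// /h /= !rev_ordK.
by move=> /pair_equal_spec[/= -> ->]; rewrite inE /= in kl; rewrite !rev_ordK ltn_rev_ord.
Qed.

Lemma mallows_prob213 (R : realType) n (q : R) :
  mallows_prob q (avoiders n pattern213) = mallows_prob q (avoiders n pattern132).
Proof.
rewrite /mallows_prob (reindex_inj (inv_inj rev_complK)) /=.
apply: eq_big => s; first by rewrite -rev_compl_pattern132 avoiders_rev_compl.
by rewrite /mallows_pmf inversions_rev_compl.
Qed.

(* From [expR y >= 1 + y] with [y = x / (1 - x)]. *)
Lemma expR_le1B (R : realType) (x : R) : 0 <= x -> x < 1 -> expR (- (x / (1 - x))) <= 1 - x.
Proof.
move=> x0 x1; rewrite expRN -[leRHS]invrK lef_pV2 ?posrE ?expR_gt0 ?invr_gt0 ?subr_gt0//.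
apply: le_trans (expR_ge1Dx _); rewrite le_eqVlt; apply/orP; left; apply/eqP.
have nz : 1 - x != 0 by rewrite subr_eq0 gt_eqF.
by rewrite -{2}(divff nz) -mulrDl subrK mul1r.
Qed.

(** Each [x = q ^+ i.+1] is at most [q], so [1 - x] is at least [expR (- (x / (1 - q)))]; the sum of
    the [x] is at most [(1 - q)^-1], whence a bound uniform in [n]. *)
Lemma prod_1BX_ge (R : realType) n (q : R) : 0 < q -> q < 1 ->
  expR (- (1 - q)^-1 ^+ 2) <= \prod_(i < n) (1 - q ^+ i.+1).
Proof.
move=> q0 q1; have p0 : 0 < 1 - q by rewrite subr_gt0.
apply: (@le_trans _ _ (\prod_(i < n) expR (- (q ^+ i.+1 / (1 - q))))).
  rewrite -expR_sum ler_expR sumrN lerN2 -mulr_suml expr2 ler_pM2r ?invr_gt0//.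
  rewrite -[leRHS]mul1r ler_pdivlMr// mulrC -[_ * _]opprK -mulNr opprB.
  under eq_bigr do rewrite exprS.
  rewrite -mulr_sumr mulrCA -subrX1 -mulrN opprB; apply: mulr_ile1; rewrite ?(ltW q0) ?(ltW q1)//.
    by rewrite subr_ge0 exprn_ile1// ltW.
  by rewrite gerBl exprn_ge0// ltW.
apply: ler_prod => i _; rewrite expR_ge0 /=.
have x1 : q ^+ i.+1 <= q by rewrite exprS ler_piMr ?exprn_ile1// ltW.
have x0 : 0 <= q ^+ i.+1 by rewrite exprn_ge0// ltW.
have xlt1 := le_lt_trans x1 q1.
apply: le_trans (expR_le1B _ _ x0 xlt1); rewrite ler_expR lerN2.
by rewrite ler_wpM2l// lef_pV2 ?posrE ?subr_gt0// lerB.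
Qed.

(** * Two-sided bounds on the probability *)

Lemma mallows_prob132_ge (R : realType) n (q : R) : 0 < q -> q < 1 ->
  (1 - q) ^+ n <= mallows_prob q (avoiders n pattern132).
Proof.
move=> q0 q1; have Z0 := mallows_Z_gt0 n q0.
rewrite /mallows_prob -mulr_suml ler_pdivlMr// mallows_ZE// mulrCA divff ?mulr1; last first.
  by rewrite expf_neq0// subr_eq0 gt_eqF.
rewrite (bigD1 1%g) ?id_avoid132//= inversions1 expr0.
(* The product is at most 1, and the identity alone contributes 1 to the sum. *)
apply: (@le_trans _ _ 1); last first.
  by rewrite lerDl sumr_ge0// => s _; rewrite exprn_ge0// ltW.
apply: prodr_ile1 => i _; rewrite subr_ge0 gerBl exprn_ile1 ?exprn_ge0// ltW//.
Qed.

(** The exponential is squared because [E^-1] occurs twice: in the bound on the avoiders' weight and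
    in the inverse of [mallows_Z]. *)
Lemma mallows_prob132_le (R : realType) n (q : R) : 0 < q -> q < 1 ->
  mallows_prob q (avoiders n pattern132)
    <= (1 - q) ^+ n * expR ((1 - q)^-1 ^+ 2) ^+ 2.
Proof.
move=> q0 q1; have p0 : 0 < (1 - q) ^+ n by rewrite exprn_gt0// subr_gt0.
have := prod_1BX_ge _ n q q0 q1; set E := \prod_(i < n) _; rewrite expRN => E_ge.
have E0 : 0 < E by apply: lt_le_trans E_ge; rewrite invr_gt0 expR_gt0.
have EV : E^-1 <= expR ((1 - q)^-1 ^+ 2).
  by rewrite -[leRHS]invrK lef_pV2 ?posrE ?invr_gt0 ?expR_gt0.
rewrite /mallows_prob -mulr_suml mallows_ZE// -/E invf_div.
rewrite mulrCA ler_pM2l// expr2; apply: ler_pM => //.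
- by apply: sumr_ge0 => s _; rewrite exprn_ge0// ltW.
- by rewrite invr_ge0 ltW.
- exact: le_trans (sum_avoid132_le _ n q q0 q1) EV.
Qed.

(** * Passage to the limit of the roots *)

Local Open Scope classical_set_scope.
Local Open Scope ring_scope.

(* Squeeze: [K `^ n^-1] tends to [1]. *)
Lemma cvg_nthroot (R : realType) (u : nat -> R) (p K : R) : 0 < p -> 0 < K ->
  (forall n, p ^+ n <= u n <= p ^+ n * K) -> u n `^ (n%:R^-1) @[n --> \oo] --> p.
Proof.
move=> p0 K0 bnd.
have inv0 : (n%:R^-1 : R) @[n --> \oo] --> (0 : R).
  (* The harmonic sequence is indexed as [n.+1%:R^-1], hence the shift. *)
  by rewrite -(cvg_shiftS (fun n => n%:R^-1 : R)); exact: cvg_harmonic.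
have K1 : p * K `^ (n%:R^-1) @[n --> \oo] --> p.
  rewrite -[X in _ --> X]mulr1; apply: cvgM; first exact: cvg_cst.
  rewrite -[X in _ --> X]expR0 -[X in _ --> expR X](mul0r (ln K)) /powR gt_eqF//.
  have lnK0 : (n%:R^-1 : R) * ln K @[n --> \oo] --> 0 * ln K.
    by apply: cvgM => //; exact: cvg_cst.
  exact (cvg_comp _ _ lnK0 (@continuous_expR R _)).
(* At [n = 0] the exponent is 0 by the convention for inverses, so the squeeze is made only for
   positive [n]. *)
have root_pX n : (0 < n)%N -> (p ^+ n) `^ (n%:R^-1) = p.
  by move=> n0; rewrite -powR_mulrn ?ltW// -powRrM divff ?powRr1 ?ltW// pnatr_eq0 -lt0n.
apply: squeeze_cvgr (cvg_cst p) K1; near=> n.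
have n0 : (0 < n)%N by near: n; exact: nbhs_infty_gt.
have /andP[lo hi] := bnd n; have pn0 : 0 <= p ^+ n by rewrite exprn_ge0// ltW.
rewrite -[in X in X <= _](root_pX n n0) -[in X in _ && (_ <= X * _)](root_pX n n0).
have un0 := le_trans pn0 lo; have r0 : 0 <= n%:R^-1 :> R by rewrite invr_ge0.
rewrite -powRM ?(ltW K0)//; apply/andP; split; apply: ge0_ler_powR; rewrite ?nnegrE//.
by rewrite mulr_ge0// ltW.
Unshelve. all: by end_near. Qed.

Theorem theorem2 (R : realType) (q : R) (hq0 : 0 < q) (hq1 : q < 1) :
  (mallows_prob q (avoiders n pattern132) `^ (n%:R^-1) @[n --> \oo] --> 1 - q) /\
  (mallows_prob q (avoiders n pattern213) `^ (n%:R^-1) @[n --> \oo] --> 1 - q).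
Proof.
under [X in _ /\ X]eq_cvg do rewrite mallows_prob213.
split; apply: (cvg_nthroot _ _ _ (expR ((1 - q)^-1 ^+ 2) ^+ 2));
  rewrite ?subr_gt0 ?exprn_gt0 ?expR_gt0// => n;
  by rewrite mallows_prob132_ge// mallows_prob132_le.
Qed.
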